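(* Let $I\subset\mathbb{R}$ be an interval, let $1\le p\le\infty$, and let $f\in W^{1,p}(I)$ be a continuous real-valued function. Then $$\dim_{A,reg}^\theta\operatorname{Graph}(f)\le 1+\frac{\theta}{(1-\theta)p}$$ for all $0<\theta<\tfrac{p}{p+1}$ (interpreting $\tfrac{p}{p+1}=1$ and $\tfrac{\theta}{(1-\theta)p}=0$ when $p=\infty$).
   Context: Here $f\in W^{1,p}(I)$ means that $f$ has a weak derivative $f'$ which is a function with $f'\in L^p(I)$ (no integrability condition on $f$ itself is imposed). $\operatorname{Graph}(f)=\{(t,f(t)):t\in I\}$. For a bounded set $F\subset\mathbb{R}^2$ and $r>0$, $N(F,r)$ is the least number of sets of diameter at most $r$ needed to cover $F$; $D(\mathbf z,R)$ is the closed disc of radius $R$ centered at $\mathbf z$. For $E\subset\mathbb{R}^2$ and $\theta\in(0,1)$, $$\dim_{A,reg}^\theta(E)=\inf\{\gamma>0:\ \exists C>0 \text{ s.t. } N(D(\mathbf z,R)\cap E,r)\le C(R/r)^\gamma \text{ for all } 0<r\le R^{1/\theta}<R<1,\ \mathbf z\in E\}.$$ *)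

(* Defs.v *)
From HB Require Import structures.
From mathcomp Require Import all_boot all_order all_algebra.
From mathcomp Require Import all_classical all_reals all_analysis.
Set Implicit Arguments. Unset Strict Implicit. Unset Printing Implicit Defensive.
Import Order.TTheory GRing.Theory Num.Theory.
Import numFieldNormedType.Exports.
Local Open Scope classical_set_scope.
Local Open Scope ring_scope.

Section Defs.
Variable R : realType.

Definition edist (x y : R * R) : R :=
  Num.sqrt ((x.1 - y.1) ^+ 2 + (x.2 - y.2) ^+ 2).

Definition disc (z : R * R) (rho : R) : set (R * R) :=
  [set w | edist z w <= rho].

Definition diam_le (U : set (R * R)) (r : R) : Prop :=
  forall x y, U x -> U y -> edist x y <= r.

Definition covered_by (F : set (R * R)) (r : R) (n : nat) : Prop :=
  exists U : 'I_n -> set (R * R),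
    (forall i, diam_le (U i) r) /\ F `<=` \bigcup_(i in [set: 'I_n]) U i.

(* covering number N(F, r) (+oo if no finite cover exists) *)
Definition covnum (F : set (R * R)) (r : R) : \bar R :=
  ereal_inf [set (n%:R)%:E | n in covered_by F r].

Definition dimAreg (theta : R) (E : set (R * R)) : \bar R :=
  ereal_inf [set gamma%:E | gamma in
    [set gamma : R | 0 < gamma /\
      exists C : R, 0 < C /\
        forall (z : R * R) (r rho : R), E z -> 0 < r ->
          r <= rho `^ theta^-1 -> rho `^ theta^-1 < rho -> rho < 1 ->
          (covnum (disc z rho `&` E) r <= (C * (rho / r) `^ gamma)%:E)%E]].

Definition Graph (f : R -> R) (I : set R) : set (R * R) :=
  [set (t, f t) | t in I].

Definition smooth (phi : R -> R) : Prop :=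
  forall (n : nat) (x : R), derivable (derive1n n phi) x 1.

Definition test_fun (I : set R) (phi : R -> R) : Prop :=
  smooth phi /\
  exists K : set R, compact K /\ K `<=` interior I /\
    (forall x, ~ K x -> phi x = 0).

Definition weak_deriv (I : set R) (f g : R -> R) : Prop :=
  measurable_fun I g /\
  forall phi, test_fun I phi ->
    (\int[lebesgue_measure]_(x in I) (f x * derive1 phi x)%:E
     = - \int[lebesgue_measure]_(x in I) (g x * phi x)%:E)%E.

Definition in_Lp (I : set R) (p : \bar R) (g : R -> R) : Prop :=
  measurable_fun I g /\
  match p with
  | r%:E => (\int[lebesgue_measure]_(x in I) (`|g x| `^ r)%:E < +oo)%E
  | +oo%E => exists M : R,
      {ae (@lebesgue_measure R), forall x, I x -> `|g x| <= M}
  | -oo%E => False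
  end.

Definition W1p (I : set R) (p : \bar R) (f : R -> R) : Prop :=
  exists g : R -> R, weak_deriv I f g /\ in_Lp I p g.

Definition theta_max (p : \bar R) : R :=
  match p with
  | r%:E => r / (r + 1)
  | _ => 1
  end.

Definition dim_bound (p : \bar R) (theta : R) : R :=
  match p with
  | r%:E => 1 + theta / ((1 - theta) * r)
  | _ => 1
  end.

End Defs.

(* Main.v *)
Require Import Defs.
From HB Require Import structures.
From mathcomp Require Import all_boot all_order all_algebra.
From mathcomp Require Import all_classical all_reals all_analysis.
From mathcomp Require Import measurable_realfun ring lra.
Import Order.TTheory GRing.Theory Num.Theory.
Import numFieldNormedType.Exports.
Local Open Scope classical_set_scope.
Local Open Scope ring_scope.

(** Testing the weak derivative against smooth bumps gives
    |f x - f y| <= int_x^y |f'|.  Cut the part of the graph in a disc of radius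
    rho into about rho / r vertical strips of width r / 2; a strip in which f
    oscillates by A needs at most 1 + 4 A / r sets, so
    N <= C rho / r + (4 / r) int |f'| over an interval of length O(rho), and by
    Hoelder the integral is O(rho^(1 - 1/p)).  Since r <= rho^(1/theta), the
    extra factor rho^(-1/p) is at most (rho / r)^(theta / ((1 - theta) p)), so
    the exponent of the theorem is itself admissible in the infimum. *)

(** * Smooth bumps *)

(** Each derivative is carried as an explicit function, so closure under products, inverses and
    affine substitution is a plain induction on [n]; holding for all [n], it yields [smooth]. *)
Fixpoint nderivable (R : realType) (n : nat) (f : R -> R) : Prop :=
  if n is m.+1 then
    exists2 g : R -> R, (forall x : R, is_derive x 1 f (g x)) & nderivable R m g
  else True.
Arguments nderivable {R}.

Section Smooth.
Variable R : realType.
Implicit Types (f g : R -> R) (P Q : {poly R}).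

Lemma is_derive_derive1 f g :
  (forall x : R, is_derive x 1 f (g x)) -> derive1 f = g.
Proof.
by move=> fg; apply/funext => x; rewrite derive1E; exact: derive_val.
Qed.

Lemma smooth_nderivable f : (forall n, nderivable n f) -> smooth f.
Proof.
move=> + n; elim: n f => [|n IH] f fn x.
  by have [g fg _] := fn 1%N; exact: ex_derive.
rewrite derive1Sn; apply: IH => m.
by have [g /is_derive_derive1 ->] := fn m.+1.
Qed.

Lemma nderivableW n f : nderivable n.+1 f -> nderivable n f.
Proof.
elim: n f => // n IH f [g fg gn].
by exists g => //; exact: IH.
Qed.

Lemma nderivableD n f g :
  nderivable n f -> nderivable n g -> nderivable n (f \+ g).
Proof.
elim: n f g => // n IH f g [f' ff' f'n] [g' gg' g'n].
by exists (f' \+ g') => [x|]; [exact: is_deriveD | exact: IH].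
Qed.

Lemma nderivableM n f g :
  nderivable n f -> nderivable n g -> nderivable n (f \* g).
Proof.
elim: n f g => // n IH f g fn gn; have [f' ff' f'n] := fn.
have [g' gg' g'n] := gn.
exists ((f \* g') \+ (g \* f')) => [x|]; first exact: is_deriveM.
by apply: nderivableD; apply: IH => //; exact: nderivableW.
Qed.

Lemma nderivable_cst n (c : R) : nderivable n (cst c).
Proof.
by elim: n c => // n IH c; exists (cst 0) => // x; exact: is_derive_cst.
Qed.

(** Since (1/f)' = -(1/f)^2 f', the induction hypothesis for 1/f at the lower order suffices. *)
Lemma nderivableV n f : (forall x, f x != 0) ->
  nderivable n f -> nderivable n (fun x => (f x)^-1).
Proof.
move=> f0; elim: n => // n IH fn; have [f' ff' f'n] := fn.
have fVn := IH (nderivableW _ _ fn).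
exists (cst (-1) \* ((fun x => (f x)^-1) \* (fun x => (f x)^-1)) \* f') => [x|].
  apply: is_derive_eq (is_deriveV (f0 x) (ff' x)) _.
  by rewrite /= /GRing.scale /= expr2 invfM mulN1r.
by apply: nderivableM => //; apply: nderivableM;
  [exact: nderivable_cst | exact: nderivableM].
Qed.

Lemma is_derive_affine (a b x : R) : is_derive x 1 (fun y => a * y + b) a.
Proof.
have -> : (fun y => a * y + b) = (a \*: id) \+ cst b by [].
apply: is_derive_eq.
by rewrite addr0 /GRing.scale /= mulr1.
Qed.

Lemma is_derive_comp_affine (a b x f' : R) f :
  is_derive (a * x + b) 1 f f' ->
  is_derive x 1 (fun y => f (a * y + b)) (f' * a).
Proof.
move=> ff'; apply: (@is_derive1_comp _ f (fun y => a * y + b)).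
exact: is_derive_affine.
Qed.

Lemma nderivable_comp_affine n (a b : R) f :
  nderivable n f -> nderivable n (fun x => f (a * x + b)).
Proof.
elim: n f => // n IH f [f' ff' f'n].
exists ((fun x => f' (a * x + b)) \* cst a) => [x|].
  exact: is_derive_comp_affine.
by apply: nderivableM; [exact: IH | exact: nderivable_cst].
Qed.

(* With [u = 1/x], the functions [P(u) exp(-u)] on x > 0, extended by 0, form a
   class stable under derivation: (P(u) exp(-u))' = u^2 (P - P')(u) exp(-u). *)
Definition flat P (x : R) : R := if 0 < x then P.[x^-1] * expR (- x^-1) else 0.

Lemma flat0 P x : x <= 0 -> flat P x = 0.
Proof. by rewrite /flat leNgt => /negbTE ->. Qed.

Lemma flat_gt0 P x : 0 < x -> flat P x = P.[x^-1] * expR (- x^-1).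
Proof. by rewrite /flat => ->. Qed.

(** With u = 1/x, the series bound exp(u) >= u^(n+1)/(n+1)! gives u^n exp(-u) <= (n+1)! x. *)
Lemma norm_flatXn_le n x : `|flat 'X^n x| <= n.+1`!%:R * `|x|.
Proof.
have [x0|x0] := lerP x 0; first by rewrite flat0 // normr0 mulr_ge0.
rewrite flat_gt0 // hornerXn (gtr0_norm x0) ger0_norm; last first.
  by rewrite mulr_ge0 ?expR_ge0 // exprn_ge0 // invr_ge0 ltW.
have u0 : 0 < x^-1 by rewrite invr_gt0.
rewrite expRN ler_pdivrMr ?expR_gt0 //.
rewrite -ler_pdivrMl; last by rewrite mulr_gt0 // ltr0n fact_gt0.
apply: le_trans (expR_ge1Dxn n (ltW u0)); rewrite ler_wpDl //.
by rewrite exprS invfM [leRHS]mulrC mulrA.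
Qed.

Lemma flatD P Q x : flat (P + Q) x = flat P x + flat Q x.
Proof. by rewrite /flat; case: ifP => _; rewrite ?addr0 // hornerD mulrDl. Qed.

Lemma flatZ c P x : flat (c *: P) x = c * flat P x.
Proof. by rewrite /flat; case: ifP => _; rewrite ?mulr0 // hornerZ mulrA. Qed.

Lemma norm_flat_le P : exists C : R, forall x, `|flat P x| <= C * `|x|.
Proof.
(* The extra factor X^n makes the Horner induction work: (P X + c) X^n splits into P X^(n+1) and c
   X^n. *)
suff: forall n, exists C : R, forall x, `|flat (P * 'X^n) x| <= C * `|x|.
  by move=> /(_ 0%N); rewrite expr0 mulr1.
elim/poly_ind: P => [|P c IH] n.
  exists 0 => x; rewrite mul0r /flat.
  by case: ifP; rewrite ?horner0 ?mul0r normr0.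
have [C PC] := IH n.+1.
exists (C + `|c| * n.+1`!%:R) => x.
rewrite mulrDl -mulrA -exprS mul_polyC flatD flatZ mulrDl.
apply: le_trans (ler_normD _ _) _; apply: lerD => //.
by rewrite normrM -mulrA ler_wpM2l // norm_flatXn_le.
Qed.

Lemma continuous_flat0 P : {for 0, continuous (flat P)}.
Proof.
have [C PC] := norm_flat_le P.
suff : flat P x @[x --> (0 : R)] --> (0 : R).
  by rewrite /prop_for /continuous_at flat0.
apply/cvgr0Pnorm_le => e e0.
have C1 : 0 < `|C| + 1 by rewrite ltr_wpDl.
have eC : 0 < (`|C| + 1)^-1 * e by rewrite mulr_gt0 // invr_gt0.
exists ((`|C| + 1)^-1 * e) => // x /=; rewrite sub0r normrN => /ltW.
rewrite ler_pdivlMl //.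
apply: le_trans; apply: le_trans (PC x) _.
by rewrite ler_wpM2r // ler_wpDr // ler_norm.
Qed.

Lemma is_derive_flat P (x : R) :
  is_derive x 1 (flat P) (flat ('X^2 * (P - P^`())) x).
Proof.
have [x0|x0|->] := ltrgtP x 0.
- rewrite flat0 ?ltW //.
  apply: (@near_eq_is_derive R R R (cst 0)).
  by near=> y; rewrite flat0 // ltW //; near: y; exact: lt_nbhsl.
- rewrite flat_gt0 //.
  apply: (@near_eq_is_derive R R R (fun y => P.[y^-1] * expR (- y^-1))).
    near=> y; rewrite flat_gt0 //; near: y; exact: lt_nbhsr.
  have dV : is_derive x 1 (fun y : R => y^-1) (- x ^- 2).
    apply: is_derive_eq (is_deriveV _ (is_derive_id x 1)) _.
      by rewrite gt_eqF.
    by rewrite /GRing.scale /= mulr1.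
  have dP := is_derive1_comp (is_derive_poly P x^-1) dV.
  have dE : is_derive x 1 (fun y => expR (- y^-1)) _ :=
    @is_derive1_comp _ expR (fun y => - y^-1) x _ _
      (is_derive_expR _) (is_deriveN dV).
  apply: is_derive_eq (is_deriveM dP dE) _.
  rewrite /GRing.scale /= hornerM hornerXn hornerD hornerN exprVn; ring.
(* At 0 the difference quotient is [flat ('X * P)], continuous at 0 with value 0. *)
- rewrite flat0 //; apply/is_derive1_caratheodory.
  exists (flat ('X * P)); split; [|exact: continuous_flat0|exact: flat0].
  move=> z; rewrite (flat0 P 0) // !subr0 /flat.
  case: ifP => [z0|]; last by rewrite mul0r.
  by rewrite hornerM hornerX; field; rewrite gt_eqF.
Unshelve. all: by end_near. Qed.

Lemma nderivable_flat n P : nderivable n (flat P).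
Proof.
elim: n P => // n IH P.
by exists (flat ('X^2 * (P - P^`()))) => //; exact: is_derive_flat.
Qed.

(** [h] is exp(-1/x) for x > 0 and 0 otherwise; [k], which is x^(-2) exp(-1/x) for x > 0, is its
    derivative. *)
Let h := flat 1.
Let k := flat 'X^2.

Let h_gt0 x : 0 < x -> 0 < h x.
Proof. by move=> x0; rewrite /h flat_gt0 // hornerC mul1r expR_gt0. Qed.

Let h_ge0 x : 0 <= h x.
Proof. by rewrite /h; have [/flat0 -> //|/h_gt0 /ltW] := lerP x 0. Qed.

Let k_ge0 x : 0 <= k x.
Proof.
rewrite /k /flat; case: ifP => // x0.
by rewrite hornerXn mulr_ge0 ?expR_ge0 // exprn_ge0 // invr_ge0 ltW.
Qed.

Let is_derive_h (x : R) : is_derive x 1 h (k x).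
Proof. by have := is_derive_flat 1 x; rewrite derivC subr0 mulr1. Qed.

Let den x : R := h x + h (- 1 * x + 1).

(** If x <= 0 then 1 - x > 0, so one of the two summands is always positive. *)
Let den_gt0 x : 0 < den x.
Proof.
rewrite /den; have [x0|x0] := lerP x 0.
  by rewrite ltr_wpDl // h_gt0 //; lra.
by rewrite ltr_pwDl // h_gt0.
Qed.

(** The classical smooth transition h(x) / (h(x) + h(1 - x)), from 0 for x <= 0 to 1 for x >= 1. *)
Definition step x : R := h x * (den x)^-1.
(** The quotient rule after the terms h(x) k(x) cancel, a form whose sign is visible. *)
Definition dstep x : R :=
  (k x * h (1 - x) + h x * k (1 - x)) * (den x)^-1 * (den x)^-1.

Lemma nderivable_step n : nderivable n step.
Proof.
apply: nderivableM; first exact: nderivable_flat.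
apply: nderivableV => [x|]; first by rewrite gt_eqF.
apply: nderivableD; first exact: nderivable_flat.
by apply: nderivable_comp_affine; exact: nderivable_flat.
Qed.

Lemma is_derive_step (x : R) : is_derive x 1 step (dstep x).
Proof.
have dden : is_derive x 1 den (k x + k (- 1 * x + 1) * - 1).
  exact: is_deriveD (is_derive_h x)
    (is_derive_comp_affine (- 1) 1 x _ h (is_derive_h _)).
have den0 : den x != 0 by rewrite gt_eqF.
apply: is_derive_eq (is_deriveM (is_derive_h x) (is_deriveV den0 dden)) _.
rewrite /dstep /GRing.scale /= (_ : 1 - x = - 1 * x + 1); last by ring.
have : h x + h (- 1 * x + 1) != 0 by [].
by rewrite /den => den0'; field.
Qed.

Lemma step_ge0 x : 0 <= step x.
Proof. by rewrite mulr_ge0 // invr_ge0 ltW. Qed.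

Lemma step_le1 x : step x <= 1.
Proof. by rewrite ler_pdivrMr // mul1r /den lerDl. Qed.

Lemma step_eq0 x : x <= 0 -> step x = 0.
Proof. by move=> x0; rewrite /step /h flat0 // mul0r. Qed.

Lemma step_eq1 x : 1 <= x -> step x = 1.
Proof.
move=> x1; have := den_gt0 x; rewrite /step /den /h (flat0 _ (- 1 * x + 1)).
  by rewrite addr0 => h0; rewrite divff // gt_eqF.
lra.
Qed.

Lemma dstep_ge0 x : 0 <= dstep x.
Proof. by rewrite !mulr_ge0 ?addr_ge0 ?mulr_ge0 // invr_ge0 ltW. Qed.

Lemma dstep_eq0 x : x <= 0 \/ 1 <= x -> dstep x = 0.
Proof.
rewrite /dstep /h /k => -[x0|x1].
  by rewrite !(flat0 _ x) // !mul0r addr0 !mul0r.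
by rewrite !(flat0 _ (1 - x)) ?subr_le0 // !mulr0 addr0 !mul0r.
Qed.

(** * Bumps with a flat top *)

Section Bump.
Variables a b e : R.
Hypotheses (e0 : 0 < e) (abe : a + e <= b - e).

(** A step rising on [a, a + e] times one falling on [b - e, b]; the arguments (x - a) / e and (b -
    x) / e are written as affine maps. *)
Definition bumpf x : R :=
  step (e^-1 * x + - a / e) * step (- e^-1 * x + b / e).
Definition dbumpf x : R :=
  step (e^-1 * x + - a / e) * (dstep (- e^-1 * x + b / e) * - e^-1) +
  step (- e^-1 * x + b / e) * (dstep (e^-1 * x + - a / e) * e^-1).

Lemma nderivable_bumpf n : nderivable n bumpf.
Proof.
by apply: nderivableM; apply: nderivable_comp_affine; exact: nderivable_step.
Qed.

Lemma is_derive_bumpf (x : R) : is_derive x 1 bumpf (dbumpf x).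
Proof.
exact: is_deriveM
  (is_derive_comp_affine _ _ x _ step (is_derive_step _))
  (is_derive_comp_affine _ _ x _ step (is_derive_step _)).
Qed.

Let leftE x : e^-1 * x + - a / e = (x - a) / e.
Proof. by rewrite mulrC mulrBl mulNr. Qed.

Let rightE x : - e^-1 * x + b / e = (b - x) / e.
Proof. by rewrite mulrC mulrBl addrC mulrN. Qed.

Lemma bumpf_ge0 x : 0 <= bumpf x.
Proof. by rewrite mulr_ge0 ?step_ge0. Qed.

Lemma bumpf_le1 x : bumpf x <= 1.
Proof. by rewrite mulr_ile1 ?step_ge0 ?step_le1. Qed.

Lemma bumpf_out x : x <= a \/ b <= x -> bumpf x = 0.
Proof.
rewrite /bumpf leftE rightE => -[xa|bx].
  by rewrite step_eq0 ?mul0r // ler_pdivrMr // mul0r subr_le0.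
by rewrite mulrC step_eq0 ?mul0r // ler_pdivrMr // mul0r subr_le0.
Qed.

Lemma dbumpf_out x : x <= a \/ b <= x -> dbumpf x = 0.
Proof.
rewrite /dbumpf leftE rightE => -[xa|bx].
  have xa0 : (x - a) / e <= 0 by rewrite ler_pdivrMr // mul0r subr_le0.
  by rewrite (step_eq0 _ xa0) (dstep_eq0 _ (or_introl xa0)) !mul0r mulr0 addr0.
have bx0 : (b - x) / e <= 0 by rewrite ler_pdivrMr // mul0r subr_le0.
by rewrite (step_eq0 _ bx0) (dstep_eq0 _ (or_introl bx0)) !mul0r mulr0 addr0.
Qed.

Lemma bumpf_mid x : a + e <= x <= b - e -> bumpf x = 1.
Proof.
move=> /andP[ax xb]; rewrite /bumpf leftE rightE.
by rewrite !step_eq1 ?mulr1 // ler_pdivlMr // mul1r; lra.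
Qed.

(** Left of b - e the falling factor is constant, so only the derivative of the rising one remains;
    [dbumpf_le0] is the mirror image. *)
Lemma dbumpf_ge0 x : x <= b - e -> 0 <= dbumpf x.
Proof.
move=> xb; rewrite /dbumpf leftE rightE [dstep ((b - x) / e)]dstep_eq0.
  rewrite mul0r mulr0 add0r mulr_ge0 ?step_ge0 // mulr_ge0 ?dstep_ge0 //.
  by rewrite invr_ge0 ltW.
by right; rewrite ler_pdivlMr // mul1r; lra.
Qed.

Lemma dbumpf_le0 x : a + e <= x -> dbumpf x <= 0.
Proof.
move=> ax; rewrite /dbumpf leftE rightE [dstep ((x - a) / e)]dstep_eq0.
  rewrite mul0r mulr0 addr0 !mulrN oppr_le0.
  by rewrite mulr_ge0 ?step_ge0 // mulr_ge0 ?dstep_ge0 // invr_ge0 ltW.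
by right; rewrite ler_pdivlMr // mul1r; lra.
Qed.

Lemma dbumpf_mid x : a + e <= x <= b - e -> dbumpf x = 0.
Proof.
by move=> /andP[ax xb]; apply/eqP; rewrite eq_le dbumpf_le0 // dbumpf_ge0.
Qed.

Lemma test_fun_bumpf (I : set R) :
  `[a, b]%classic `<=` interior I -> test_fun I bumpf.
Proof.
move=> abI; split; first by apply: smooth_nderivable; exact: nderivable_bumpf.
exists `[a, b]%classic; split; first exact: segment_compact.
split => // x /= /negP; rewrite in_itv /= negb_and -!ltNge => /orP[/ltW|/ltW] ?.
  by apply: bumpf_out; left.
by apply: bumpf_out; right.
Qed.

End Bump.

End Smooth.

(** * Oscillation and weak derivatives *)

(** For the side of the weak identity that carries g: a cut-off with values in [0, 1] does not
    increase |g|, and outside [E] the integrand vanishes. *)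
Lemma abse_integral_mul_le (R : realType) (I E : set R) (g phi : R -> R) :
  measurable I -> measurable E ->
  measurable_fun I g -> measurable_fun setT phi ->
  (forall x, 0 <= phi x <= 1) -> (forall x, ~ E x -> phi x = 0) ->
  (`|\int[lebesgue_measure]_(x in I) (g x * phi x)%:E| <=
    \int[lebesgue_measure]_(x in I `&` E) `|g x|%:E)%E.
Proof.
move=> mI mE mg mphi phi01 phi0.
have -> : (\int[lebesgue_measure]_(x in I) (g x * phi x)%:E =
    \int[lebesgue_measure]_(x in I `&` E) (g x * phi x)%:E)%E.
  rewrite integral_mkcondr; apply: eq_integral => x _; rewrite patchE.
  by case: ifPn => // /negP; rewrite inE => /phi0 ->; rewrite mulr0.
have mIE : measurable (I `&` E) by exact: measurableI.
have mgIE : measurable_fun (I `&` E) g by apply: measurable_funS mg.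
have mgphi : measurable_fun (I `&` E) (fun x => g x * phi x).
  by apply: measurable_funM => //; exact: measurable_funTS.
have mF : measurable_fun (I `&` E) (EFin \o (fun x => g x * phi x)).
  exact/measurable_EFinP.
have := @le_abse_integral _ _ R (@lebesgue_measure R) _ _ mIE mF.
move=> /le_trans; apply.
apply: ge0_le_integral => //.
- exact: measurableT_comp.
- by apply/measurable_EFinP; exact: measurableT_comp.
- move=> x _; rewrite abse_EFin lee_fin normrM ler_piMr //.
  by have /andP[p0 p1] := phi01 x; rewrite ger0_norm.
Qed.

(** * Integration of continuous functions on a segment *)

Section IntegralLemmas.
Variable R : realType.
Implicit Types (f g : R -> R) (I : set R).
Local Notation mu := (@lebesgue_measure R).

Lemma integral_support (D E : set R) (F : R -> \bar R) : E `<=` D ->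
  (forall x, ~ E x -> F x = 0%E) ->
  (\int[mu]_(x in D) F x = \int[mu]_(x in E) F x)%E.
Proof.
move=> ED F0; rewrite integral_mkcond [RHS]integral_mkcond.
apply: eq_integral => x _; rewrite !patchE; case: (boolP (x \in E)) => [xE|].
  by rewrite ifT // inE; apply: ED; exact: set_mem.
by move=> /negP; rewrite inE => /F0 ->; case: ifP.
Qed.

Lemma is_derive_continuous f g (x : R) :
  (forall x : R, is_derive x 1 f (g x)) -> {for x, continuous f}.
Proof.
move=> fg; apply: differentiable_continuous.
by apply/derivable1_diffP; exact: ex_derive.
Qed.

Lemma Rintegral_FTC2 f g (a b : R) : a < b -> continuous g ->
  (forall x : R, is_derive x 1 f (g x)) ->
  \int[mu]_(x in `[a, b]) g x = f b - f a.
Proof.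
move=> ab cg fg; rewrite /Rintegral (@continuous_FTC2 _ _ f) //.
- exact: continuous_subspaceT.
- have cf x : {for x, continuous f} := is_derive_continuous _ _ x fg.
  split; first by move=> x _; exact: ex_derive.
    exact: cvg_at_right_filter (cf a).
  exact: cvg_at_left_filter (cf b).
- by move=> x _; rewrite derive1E; exact: derive_val.
Qed.

Lemma continuous_itv_integrable f (a b : R) :
  {within `[a, b], continuous f} -> mu.-integrable `[a, b] (EFin \o f).
Proof.
by move=> cf; apply: continuous_compact_integrable => //;
  exact: segment_compact.
Qed.

Lemma within_continuousM f g (A : set R) : {within A, continuous f} ->
  continuous g -> {within A, continuous (fun x => f x * g x)}.
Proof.
move=> /subspace_continuousP cf cg; apply/subspace_continuousP => x Ax.
apply: cvgM; first exact: cf.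
exact: (cvg_trans (cvg_app g (cvg_within _)) (cg x)).
Qed.

(** The integral of w = W' is W b - W a. The hypothesis constrains f only where w is nonzero, and a
    negative [k] accommodates w <= 0, as on the falling side of a bump. *)
Lemma weighted_mean_close f w W (c k a b : R) : a < b ->
  {within `[a, b], continuous f} -> continuous w ->
  (forall x : R, is_derive x 1 W (w x)) ->
  (forall x, a <= x <= b -> `|(f x - c) * w x| <= k * w x) ->
  `|\int[mu]_(x in `[a, b]) (f x * w x) - c * (W b - W a)| <= k * (W b - W a).
Proof.
move=> ab cf cw Ww fk.
have iw : mu.-integrable `[a, b] (EFin \o w).
  by apply: continuous_itv_integrable; exact: continuous_subspaceT.
have ifw : mu.-integrable `[a, b] (EFin \o (fun x => f x * w x)).
  by apply: continuous_itv_integrable; exact: within_continuousM.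
have icw r : mu.-integrable `[a, b] (EFin \o (fun x => r * w x)).
  apply: continuous_itv_integrable; apply: continuous_subspaceT => x.
  by apply: cvgM; [exact: cvg_cst | exact: cw].
have cd : {within `[a, b], continuous (fun x => f x * w x - c * w x)}.
  apply/subspace_continuousP => x abx; apply: cvgB.
    by move/subspace_continuousP: (within_continuousM _ _ _ cf cw); exact.
  apply: cvgM; first exact: cvg_cst.
  exact: (cvg_trans (cvg_app w (cvg_within _)) (cw x)).
have icd : mu.-integrable `[a, b] (EFin \o (fun x => f x * w x - c * w x)).
  exact: continuous_itv_integrable.
have icdn : mu.-integrable `[a, b]
    (EFin \o (fun x => `|f x * w x - c * w x|)).
  apply: continuous_itv_integrable; apply/subspace_continuousP => x abx.
  by apply: cvg_norm; move/subspace_continuousP: cd; exact.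
rewrite -(Rintegral_FTC2 _ _ _ _ ab cw Ww) -!RintegralZl // -RintegralB //.
apply: le_trans (le_normr_Rintegral _ icd) _ => //.
apply: le_Rintegral => //.
by move=> x /=; rewrite in_itv /= => axb; rewrite -mulrBl; exact: fk.
Qed.

End IntegralLemmas.

(** * Oscillation bounded by the integral of the weak derivative *)

Section WeakDerivative.
Variable R : realType.
Implicit Types (f g : R -> R) (I : set R).
Local Notation mu := (@lebesgue_measure R).

Lemma within_continuous_ball f I x (d : R) : {within I, continuous f} -> I x ->
  0 < d ->
  exists2 e : R, 0 < e & forall u, I u -> `|x - u| < e -> `|f u - f x| <= d.
Proof.
move=> /subspace_continuousP cf Ix d0.
have /cvgrPdist_le /(_ _ d0) := cf x Ix.
rewrite /within /= => /nbhs_ballP[e /= e0 eI]; exists e => // u Iu xu.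
by rewrite distrC; exact: eI.
Qed.

(* Testing the weak derivative against a bump rising from 0 to 1 just after x
   and falling back just before y turns the left-hand side into a weighted mean
   of f near x minus a weighted mean of f near y. *)
Lemma weak_deriv_osc I f g (s t x y : R) : is_interval I ->
  {within I, continuous f} -> weak_deriv I f g ->
  I x -> I y -> s <= x -> x < y -> y < t ->
  (`|f x - f y|%:E <= \int[mu]_(u in I `&` `[s, t[) `|g u|%:E)%E.
Proof.
move=> itvI cf [mg fg] Ix Iy sx xy yt.
have mI := is_interval_measurable itvI.
(* The tolerance [d'] is split evenly between the errors at [x] and at [y]. *)
apply/lee_addgt0Pr => /= d' d'0; pose d : R := d' / 2.
have d0 : 0 < d by rewrite divr_gt0.
have [e1 e10 fx] := within_continuous_ball _ _ _ _ cf Ix d0.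
have [e2 e20 fy] := within_continuous_ball _ _ _ _ cf Iy d0.
(* The bump rises on [x + e, x + 2e] and falls on [y - 2e, y - e], close enough to x and y and
   without crossing. The gap [e] at each end keeps its support off x and y, which may be endpoints
   of [I]. *)
pose e : R := Num.min (Num.min e1 e2) (y - x) / 4.
have [e0 ee1 ee2 exy] : [/\ 0 < e, 2 * e < e1, 2 * e < e2 & 4 * e <= y - x].
  have m0 : 0 < Num.min (Num.min e1 e2) (y - x).
    by rewrite !lt_min e10 e20 subr_gt0.
  have : Num.min (Num.min e1 e2) (y - x) <= Num.min e1 e2.
    by rewrite ge_min lexx.
  have : Num.min (Num.min e1 e2) (y - x) <= y - x by rewrite ge_min lexx orbT.
  have : Num.min e1 e2 <= e1 by rewrite ge_min lexx.
  have : Num.min e1 e2 <= e2 by rewrite ge_min lexx orbT.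
  by rewrite /e; split; lra.
pose a : R := x + e; pose b : R := y - e; pose m : R := (x + y) / 2.
have abe : a + e <= b - e by rewrite /a /b; lra.
have [am mb] : a < m /\ m < b by rewrite /a /b /m; split; lra.
have [aem mbe] : a + e <= m /\ m <= b - e by rewrite /a /b /m; split; lra.
have xyI : `]x, y[%classic `<=` I.
  move=> u; rewrite /= in_itv /= => /andP[xu uy].
  by apply: (itvI x y) => //; rewrite !ltW.
have abI : `[a, b]%classic `<=` I.
  apply: subset_trans xyI => u; rewrite /= !in_itv /= /a /b => /andP[au ub].
  by apply/andP; split; lra.
pose phi : R -> R := bumpf _ a b e; pose dphi : R -> R := dbumpf _ a b e.
have phiP (u : R) : is_derive u 1 phi (dphi u) by exact: is_derive_bumpf.
have phi' : derive1 phi = dphi by apply: is_derive_derive1.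
(* A second derivative of [phi] makes [dphi] differentiable, hence continuous. *)
have cdphi : continuous dphi.
  have [h phih [h' hh' _]] := nderivable_bumpf _ a b e 2.
  rewrite -phi' (is_derive_derive1 _ _ _ phih) => u.
  exact: is_derive_continuous hh'.
have test_phi : test_fun I phi.
  apply: test_fun_bumpf => // u; rewrite /= in_itv /= => /andP[au ub].
  have : `]x, y[%classic `<=` interior I.
    by rewrite -open_subsetE //; exact: interval_open.
  by apply; rewrite /= in_itv /= /a /b in au ub *; apply/andP; split; lra.
have out u : ~ `[a, b]%classic u -> u <= a \/ b <= u.
  rewrite /= => /negP; rewrite in_itv /= negb_and -!ltNge.
  by move=> /orP[] /ltW; [left | right].
have cfab : {within `[a, b], continuous f}.
  exact: continuous_subspaceW abI cf.
have cfp : {within `[a, b], continuous (fun u => f u * dphi u)}.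
  exact: within_continuousM.
have ifp := continuous_itv_integrable _ _ _ _ cfp.
have LHS : (\int[mu]_(u in I) (f u * derive1 phi u)%:E =
            (\int[mu]_(u in `[a, b]) (f u * dphi u))%:E)%E.
  rewrite phi' (integral_support _ _ `[a, b]%classic) //; last first.
    by move=> u /out abu; rewrite /dphi dbumpf_out // mulr0.
  by rewrite /Rintegral fineK //; exact: integrable_fin_num.
have phia : phi a = 0 by apply: bumpf_out => //; left.
have phib : phi b = 0 by apply: bumpf_out => //; right.
have phim : phi m = 1 by apply: bumpf_mid; rewrite ?aem.
(* On [a, m] the weight [dphi] is nonnegative, has mass phi m - phi a = 1 and vanishes beyond a +
   e. *)
have Lam : `|\int[mu]_(u in `[a, m]) (f u * dphi u) - f x| <= d.
  have := weighted_mean_close _ f dphi phi (f x) d a m am.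
  rewrite phia phim subr0 !mulr1; apply => //.
    apply: continuous_subspaceW cfab => u; rewrite /= !in_itv /=.
    by move=> /andP[-> um]; rewrite (le_trans um) // ltW.
  move=> u /andP[au um].
  have dphi0 : 0 <= dphi u by apply: dbumpf_ge0; rewrite ?(le_trans um).
  have [uae|uae] := lerP u (a + e); last first.
    by rewrite /dphi dbumpf_mid ?mulr0 ?normr0 // (ltW uae) (le_trans um).
  rewrite normrM (ger0_norm dphi0) ler_wpM2r // fx //.
    by apply: abI; rewrite /= in_itv /= au (le_trans um) // ltW.
  by move: au uae; rewrite /a => au uae; rewrite distrC ger0_norm; lra.
(* On [m, b] the weight is nonpositive of mass -1, hence the constant [- d]. *)
have Lmb : `|\int[mu]_(u in `[m, b]) (f u * dphi u) + f y| <= d.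
  have := weighted_mean_close _ f dphi phi (f y) (- d) m b mb.
  rewrite phib phim sub0r mulrN1 opprK mulrNN mulr1; apply => //.
    apply: continuous_subspaceW cfab => u; rewrite /= !in_itv /=.
    by move=> /andP[mu' ->]; rewrite (le_trans _ mu') // ltW.
  move=> u /andP[mu' ub].
  have dphi0 : dphi u <= 0 by apply: dbumpf_le0; rewrite ?(le_trans aem).
  have [uae|uae] := lerP (b - e) u; last first.
    by rewrite /dphi dbumpf_mid ?mulr0 ?normr0 // (ltW uae) (le_trans aem).
  rewrite normrM (ler0_norm dphi0) mulrN mulNr lerN2 ler_wnM2r // fy //.
    by apply: abI; rewrite /= in_itv /= ub (le_trans _ mu') // ltW.
  by move: ub uae; rewrite /b => ub uae; rewrite ger0_norm; lra.
have split_ab : \int[mu]_(u in `[a, b]) (f u * dphi u) =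
    \int[mu]_(u in `[a, m]) (f u * dphi u) +
    \int[mu]_(u in `[m, b]) (f u * dphi u).
  rewrite -(@Rintegral_itv_obnd_cbnd _ m); last first.
    apply: integrableS ifp => // u; rewrite /= !in_itv /=.
    by move=> /andP[mu' ->]; rewrite ltW // (lt_trans am).
  rewrite -(@Rintegral_itvB _ _ (BLeft a) (BRight b) m) //.
  - by ring.
  - by rewrite bnd_simp ltW.
  - by rewrite bnd_simp ltW.
(* f x - f y is the full integral minus the two errors just bounded. *)
have fxy : `|f x - f y| <= `|\int[mu]_(u in `[a, b]) (f u * dphi u)| + d'.
  rewrite (_ : f x - f y = \int[mu]_(u in `[a, b]) (f u * dphi u) -
    (\int[mu]_(u in `[a, m]) (f u * dphi u) - f x) -
    (\int[mu]_(u in `[m, b]) (f u * dphi u) + f y)); last first.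
    by rewrite split_ab; ring.
  apply: le_trans (ler_normB _ _) _.
  apply: (@le_trans _ _ (`|\int[mu]_(u in `[a, b]) (f u * dphi u)| + d + d)).
    apply: lerD => //; apply: le_trans (ler_normB _ _) _; exact: lerD.
  by rewrite /d; lra.
apply: (@le_trans _ _ (`|\int[mu]_(u in `[a, b]) (f u * dphi u)| + d')%:E).
  by rewrite lee_fin.
rewrite EFinD leeD2r //.
rewrite (_ : (`|_|)%:E = `|(\int[mu]_(u in `[a, b]) (f u * dphi u))%:E|%E) //.
(* The weak identity trades the integral of f phi' for that of g phi, up to sign. *)
rewrite -LHS (fg _ test_phi) abseN.
have mphi : measurable_fun setT phi.
  apply: continuous_measurable_fun => u; exact: is_derive_continuous phiP.
apply: abse_integral_mul_le => // u.
  by rewrite bumpf_ge0 bumpf_le1.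
move=> stu; apply: bumpf_out => //; apply: out => abu; apply: stu.
move: abu; rewrite /= !in_itv /= /a /b => /andP[au ub].
by apply/andP; split; lra.
Qed.

End WeakDerivative.

(** * Local integral bounds for an L^p function *)

Definition inv_exponent (R : realType) (p : \bar R) : R :=
  if p is r%:E then r^-1 else 0.

(* Integrated with l = rho^(-1/r), this plays the role of Hoelder's inequality. *)
Lemma norm_le_powR (R : realType) (l r x : R) : 0 < l -> 1 <= r ->
  `|x| <= l + l `^ (1 - r) * `|x| `^ r.
Proof.
move=> l0 r1; have [xl|lx] := lerP `|x| l.
  by rewrite ler_wpDr // mulr_ge0 // powR_ge0.
have x0 : 0 < `|x| := lt_trans l0 lx.
rewrite ler_wpDl ?(ltW l0) //.
have {1}-> : `|x| = `|x| `^ (1 - r) * `|x| `^ r.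
  by rewrite -powRD ?(gt_eqF x0) ?implybT // subrK powRr1 // ltW.
rewrite ler_wpM2r ?powR_ge0 // -opprB !powRN lef_pV2 ?posrE ?powR_gt0 //.
by apply: ge0_ler_powR; rewrite ?subr_ge0 ?nnegrE // ltW.
Qed.

(** For finite p, [norm_le_powR] is integrated over a set of measure at most 3 rho; for p = oo,
    where [inv_exponent] is 0, the essential bound suffices. The factor 3 leaves room for rounding a
    width 2 rho up to whole strips. *)
Lemma in_Lp_local_bound (R : realType) (I : set R) (p : \bar R) (g : R -> R) :
  measurable I -> (1%:E <= p)%E -> in_Lp I p g ->
  exists2 M : R, 0 <= M & forall s L rho : R, 0 < rho -> 0 <= L <= 3 * rho ->
    (\int[lebesgue_measure]_(u in I `&` `[s, (s + L)%R[) `|g u|%:E <=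
      (M * (rho * rho `^ (- inv_exponent R p)))%:E)%E.
Proof.
move=> mI p1 [mg gp].
have mIs (s t : R) : measurable (I `&` `[s, t[%classic) by exact: measurableI.
have muIs (s L : R) : 0 <= L ->
    (@lebesgue_measure R (I `&` `[s, (s + L)%R[%classic) <= L%:E)%E.
  move=> L0; apply: (@le_trans _ _
    (lebesgue_measure (`[s, (s + L)%R[%classic : set R))).
    apply: le_measure; rewrite ?inE;
      [exact: mIs | exact: measurable_itv | exact: subIsetr].
  rewrite lebesgue_measure_itv /= lte_fin; case: ifPn => // _.
  by rewrite -EFinB lee_fin; lra.
have mgIs (s t : R) : measurable_fun (I `&` `[s, t[) (fun u => `|g u|).
  apply: measurableT_comp => //; by apply: measurable_funS mg.
case: p p1 gp => [r| |] //= p1 gp.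
  have mgr : measurable_fun I (fun u => `|g u| `^ r).
    by apply: (measurableT_comp (measurable_powR r)); exact: measurableT_comp.
  pose N := fine (\int[lebesgue_measure]_(u in I) (`|g u| `^ r)%:E)%E.
  have gr0 u : I u -> (0 <= (`|g u| `^ r)%:E)%E by rewrite lee_fin powR_ge0.
  have I0 : (0 <= \int[lebesgue_measure]_(u in I) (`|g u| `^ r)%:E)%E.
    exact: integral_ge0.
  have N0 : 0 <= N by exact: fine_ge0.
  have NE : (\int[lebesgue_measure]_(u in I) (`|g u| `^ r)%:E)%E = N%:E.
    by rewrite /N fineK // ge0_fin_numE.
  (* 3 comes from the measure of the set, [N] from the integral of |g|^r over [I]. *)
  exists (3 + N); first by rewrite addr_ge0.
  move=> s L rho rho0 /andP[L0 L3]; rewrite lee_fin in p1.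
  pose l := rho `^ (- r^-1).
  have l0 : 0 < l by rewrite powR_gt0.
  pose E := I `&` `[s, (s + L)%R[%classic.
  have mgE : measurable_fun E (fun u => `|g u| `^ r).
    by apply: measurable_funS mgr => // u [].
  apply: (@le_trans _ _ (\int[lebesgue_measure]_(u in E)
     (l%:E + (l `^ (1 - r))%:E * (`|g u| `^ r)%:E))%E).
    apply: ge0_le_integral => //; first exact: mIs.
    - by apply/measurable_EFinP; exact: mgIs.
    - apply: emeasurable_funD => //; apply: emeasurable_funM => //.
      exact/measurable_EFinP.
    - by move=> u _; rewrite -EFinM -EFinD lee_fin norm_le_powR.
  rewrite ge0_integralD //; last 4 first.
  - exact: mIs.
  - by move=> u _; rewrite lee_fin ltW.
  - by move=> u _; rewrite -EFinM lee_fin mulr_ge0 ?powR_ge0.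
  - by apply: emeasurable_funM => //; exact/measurable_EFinP.
  rewrite ge0_integralZl_EFin ?powR_ge0 //; last 2 first.
  - exact: mIs.
  - exact/measurable_EFinP.
  rewrite integral_cst; last exact: mIs.
  (* Both terms scale alike: rho l = l^(1 - r) = rho^(1 - 1/r). *)
  have -> : (3 + N) * (rho * rho `^ (- r^-1)) =
      l * (3 * rho) + l `^ (1 - r) * N.
    rewrite /l -powRrM (_ : - r^-1 * (1 - r) = 1 - r^-1); last first.
      by field; rewrite gt_eqF // (lt_le_trans ltr01).
    rewrite powRD ?(gt_eqF rho0) ?implybT // powRr1 ?ltW //; ring.
  rewrite EFinD; apply: leeD.
    rewrite EFinM lee_pmul2l ?lte_fin //; apply: le_trans (muIs _ _ L0) _.
    by rewrite lee_fin.
  rewrite EFinM lee_wpmul2l ?lee_fin ?powR_ge0 // -NE.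
  apply: ge0_subset_integral => //; first exact: mIs.
    exact/measurable_EFinP.
  exact: subIsetl.
(* [|M|] is taken because [M] is not known to be nonnegative. *)
case: gp => M gM; exists (3 * `|M|); first by rewrite mulr_ge0.
move=> s L rho rho0 /andP[L0 L3].
pose E := I `&` `[s, (s + L)%R[%classic.
apply: (@le_trans _ _ (\int[lebesgue_measure]_(u in E) `|M|%:E)%E).
  apply: ae_ge0_le_integral => //; first exact: mIs.
  - by apply/measurable_EFinP; exact: mgIs.
  - case: gM => A [mA A0 gA]; exists A; split => // u /= gu.
    apply: gA => /= guM; apply: gu => -[/guM {}guM _].
    by rewrite lee_fin (le_trans guM) // ler_norm.
rewrite integral_cst; last exact: mIs.
apply: (@le_trans _ _ (`|M|%:E * L%:E)%E).
  by rewrite lee_wpmul2l ?lee_fin // muIs.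
by rewrite -EFinM lee_fin oppr0 powRr0 mulr1 -mulrA mulrCA ler_wpM2l.
Qed.

(** * Covering the graph *)

(* Unqualified, [covered_by] is the unrelated notion of classical_sets. *)
Local Notation covered_by := Defs.covered_by.

Section Covering.
Variable R : realType.
Implicit Types (F G I : set R) (f : R -> R).

Lemma covered_by_setU (F G : set (R * R)) (r : R) n m :
  covered_by F r n -> covered_by G r m -> covered_by (F `|` G) r (n + m).
Proof.
move=> [U [dU FU]] [U' [dU' GU']].
exists (fun i => match fintype.split i with inl j => U j | inr k => U' k end).
split=> [i|x]; first by case: fintype.split => j; [exact: dU | exact: dU'].
move=> [/FU [j _ Uj]|/GU' [j _ Uj]].
  by exists (lshift m j) => //; rewrite (unsplitK (inl _ j)).
by exists (rshift n j) => //; rewrite (unsplitK (inr _ j)).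
Qed.

Lemma covered_by_subset (F G : set (R * R)) (r : R) n :
  F `<=` G -> covered_by G r n -> covered_by F r n.
Proof.
by move=> FG [U [dU GU]]; exists U; split => //; exact: subset_trans GU.
Qed.

(** The graph over [F] lies in a rectangle of width w and height 2 A, covered by stacked squares of
    side w, whose diameter w sqrt 2 is below r. *)
Lemma covered_by_strip (F : set R) f (r w s A : R) : 0 < w -> 2 * w <= r ->
  0 <= A -> F `<=` `[s, (s + w)%R[%classic ->
  (forall u v, F u -> F v -> `|f u - f v| <= A) ->
  exists2 n : nat, n%:R <= 1 + 2 / w * A & covered_by (Graph f F) r n.
Proof.
move=> w0 wr A0 Fs fA.
have [->|/set0P[t0 Ft0]] := eqVneq F set0.
  exists 0%N; first by rewrite addr_ge0 // mulr_ge0 // divr_ge0 // ltW.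
  by exists (fun=> set0); split => // z [].
(* The values of f on [F] lie in [c, c + 2 A], and [q] is the height of that range in units of w. *)
pose c := f t0 - A; pose q := 2 / w * A.
have q0 : 0 <= q by rewrite mulr_ge0 // divr_ge0 // ltW.
exists (Num.truncn q).+1.
  by have /andP[q1 _] := truncn_itv q0; rewrite -natr1 addrC lerD2l.
exists (fun k : 'I_(Num.truncn q).+1 => [set z : R * R |
  s <= z.1 <= s + w /\ c + k%:R * w <= z.2 <= c + (k%:R + 1) * w]).
split=> [k x y /= [/andP[x1 x1'] /andP[x2 x2']] [/andP[y1 y1'] /andP[y2 y2']]|].
  rewrite /edist -[leRHS]ger0_norm; last by lra.
  rewrite -sqrtr_sqr ler_wsqrtr //.
  have sq (a : R) : - w <= a <= w -> a ^+ 2 <= w ^+ 2.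
    move=> aw; rewrite -[leLHS]real_normK ?num_real //.
    by rewrite lerXn2r ?nnegrE ?(ltW w0) // ler_norml.
  have h1 := sq (x.1 - y.1); have h2 := sq (x.2 - y.2).
  have h3 : (2 * w) ^+ 2 <= r ^+ 2 by rewrite lerXn2r ?nnegrE; lra.
  have {}h1 : (x.1 - y.1) ^+ 2 <= w ^+ 2 by apply: h1; lra.
  have {}h2 : (x.2 - y.2) ^+ 2 <= w ^+ 2 by apply: h2; lra.
  have : 0 <= w ^+ 2 by rewrite sqr_ge0.
  by rewrite exprMn in h3; lra.
move=> _ [t Ft <-].
have tt0 := fA _ _ Ft Ft0; have [tl tr] : - A <= f t - f t0 /\ f t - f t0 <= A.
  by move: tt0; rewrite ler_norml => /andP.
(* The integer part of [v] selects the square; as v <= q, it is a valid index. *)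
pose v := (f t - c) / w.
have v0 : 0 <= v by rewrite divr_ge0 ?(ltW w0) // /c; lra.
have vq : v <= q.
  rewrite /v /q [2 / w]mulrC -mulrA mulrC.
  by rewrite ler_wpM2l ?invr_ge0 ?(ltW w0) // /c; lra.
have /andP[v1 v2] := truncn_itv v0.
have kq : (Num.truncn v < (Num.truncn q).+1)%N.
  rewrite ltnS truncn_le_nat ?(le_lt_trans vq) //.
  by have /andP[] := truncn_itv q0.
exists (Ordinal kq) => //=.
have := Fs _ Ft; rewrite /= in_itv /= => /andP[-> /ltW ->]; split=> //.
rewrite natr1; move: v1 v2; rewrite /v ler_pdivlMr // ltr_pdivrMr // => v1 v2.
by apply/andP; split; lra.
Qed.

(** [V s t] stands for the integral of |g| over the part of [I] in [s, t[. Each strip costs 1 plus 2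
    / w times its share of [V], and superadditivity bounds the sum of the shares by [V] of the
    whole. *)
Lemma covered_by_strips I f (V : R -> R -> R) (r w : R) :
  0 < w -> 2 * w <= r -> (forall s t, 0 <= V s t) ->
  (forall s t u, s <= t -> t <= u -> V s t + V t u <= V s u) ->
  (forall s t u v, I u -> I v -> s <= u -> u < v -> v < t ->
    `|f u - f v| <= V s t) ->
  forall (m : nat) (s : R), exists2 n : nat,
    n%:R <= m%:R + 2 / w * V s (s + m%:R * w) &
    covered_by (Graph f (I `&` `[s, (s + m%:R * w)%R[%classic)) r n.
Proof.
move=> w0 wr V0 VD fV m s; elim: m => [|m [n nm cn]].
  exists 0%N; first by rewrite add0r mulr_ge0 // divr_ge0 // ltW.
  exists (fun=> set0); split=> [i x y []|z [t [_ +] _]].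
  by rewrite /= in_itv /= mul0r addr0 => /andP[/le_lt_trans h /h]; rewrite ltxx.
pose t := s + m%:R * w.
have tw : s + m.+1%:R * w = t + w by rewrite /t -natr1 mulrDl mul1r addrA.
have [n' nA cn'] : exists2 n' : nat, n'%:R <= 1 + 2 / w * V t (t + w) &
    covered_by (Graph f (I `&` `[t, (t + w)%R[%classic)) r n'.
  apply: covered_by_strip (V0 _ _) _ _ => // u v [Iu ] /=.
  rewrite in_itv /= => /andP[tu uw] [Iv /=]; rewrite in_itv /= => /andP[tv vw].
  have [uv|vu|->] := ltgtP u v.
  - exact: fV.
  - by rewrite distrC; exact: fV.
  - by rewrite subrr normr0.
exists (n + n')%N.
  have st : s <= t by rewrite /t lerDl mulr_ge0 // ltW.
  have := VD s t (t + w) st; rewrite lerDl => /(_ (ltW w0)) Vst.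
  have : 2 / w * (V s t + V t (t + w)) <= 2 / w * V s (t + w).
    by rewrite ler_wpM2l // divr_ge0 // ltW.
  by rewrite tw natrD -natr1 mulrDr; move: nm; rewrite -/t; lra.
apply: covered_by_subset (covered_by_setU _ _ _ _ _ cn cn').
move=> _ [u [Iu +] <-]; rewrite /= in_itv /= tw => /andP[su ut].
have [utm|tu] := ltrP u t; [left | right]; exists u => //; split => //.
  by rewrite /= in_itv /= su.
by rewrite /= in_itv /= tu.
Qed.

End Covering.

(** * Exponents and the final count *)

Lemma dim_boundE (R : realType) (p : \bar R) (theta : R) : (1%:E <= p)%E ->
  dim_bound p theta = 1 + inv_exponent R p * (theta / (1 - theta)).
Proof.
case: p => [r| |] //= p1; rewrite ?mul0r ?addr0 //.
by rewrite invfM [r^-1 * _]mulrC !mulrA.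
Qed.

Lemma inv_exponent_ge0 (R : realType) (p : \bar R) :
  (1%:E <= p)%E -> 0 <= inv_exponent R p.
Proof.
by case: p => [r| |] //=; rewrite lee_fin invr_ge0 => /(le_trans ler01).
Qed.

Lemma theta_max_le1 (R : realType) (p : \bar R) :
  (1%:E <= p)%E -> theta_max p <= 1.
Proof.
case: p => [r| |] //=; rewrite lee_fin => r1.
by rewrite ler_pdivrMr ?mul1r; lra.
Qed.

(* [r <= rho^(1/theta)] amounts to [rho / r >= rho^(- (1 - theta) / theta)],
   whose power [e theta / (1 - theta)] is [rho^(-e)]. *)
Lemma powR_ratio_ge (R : realType) (theta e r rho : R) :
  0 < theta < 1 -> 0 <= e ->
  0 < r -> 0 < rho -> r <= rho `^ theta^-1 ->
  rho `^ (- e) <= (rho / r) `^ (e * (theta / (1 - theta))).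
Proof.
move=> /andP[t0 t1] e0 r0 rho0 rle.
have -> : - e = (1 - theta^-1) * (e * (theta / (1 - theta))) by field; lra.
rewrite (powRrM rho) ge0_ler_powR ?nnegrE ?powR_ge0 ?divr_ge0
  ?(ltW r0) ?(ltW rho0) //.
  by rewrite mulr_ge0 // divr_ge0; lra.
rewrite powRD ?(gt_eqF rho0) ?implybT // powRr1 ?(ltW rho0) // powRN.
by rewrite ler_wpM2l ?(ltW rho0) // lef_pV2 // posrE powR_gt0.
Qed.

(** Horizontal distance is at most Euclidean distance; the strict inequality on the right serves the
    half-open interval. *)
Lemma disc_Graph_sub (R : realType) (f : R -> R) (I : set R) (t0 s t rho : R) :
  s <= t0 - rho -> t0 + rho < t ->
  disc (t0, f t0) rho `&` Graph f I `<=` Graph f (I `&` `[s, t[%classic).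
Proof.
move=> st0 t0t z [+ [u Iu uz]]; rewrite -uz /disc /edist /= => du.
exists u => //; split => //; rewrite /= in_itv /=.
have : `|t0 - u| <= rho.
  apply: le_trans du; rewrite -sqrtr_sqr ler_wsqrtr // lerDl.
  exact: sqr_ge0.
by rewrite ler_norml => /andP[? ?]; apply/andP; split; lra.
Qed.

Theorem theorem1p3 (R : realType) (I : set R) (p : \bar R) (f : R -> R) :
  is_interval I ->
  (1%:E <= p)%E ->
  W1p I p f ->
  {within I, continuous f} ->
  forall theta : R, 0 < theta -> theta < theta_max p ->
    (dimAreg theta (Graph f I) <= (dim_bound p theta)%:E)%E.
Proof.
move=> itvI p1 [g [gf gp]] cf theta theta0 theta_max.
have theta1 : theta < 1 := lt_le_trans theta_max (theta_max_le1 _ _ p1).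
have mI := is_interval_measurable itvI.
have [mg _] := gf.
have [M M0 gM] := in_Lp_local_bound _ _ _ _ mI p1 gp.
have e0 := inv_exponent_ge0 _ _ p1.
rewrite dim_boundE //; clear p1.
set e := inv_exponent R p in e0 gM *.
have a0 : 0 <= e * (theta / (1 - theta)).
  by rewrite mulr_ge0 // divr_ge0; lra.
have mIs (s t : R) : measurable (I `&` `[s, t[%classic) by exact: measurableI.
have mgIs (s t : R) :
    measurable_fun (I `&` `[s, t[) (EFin \o (fun u => `|g u|)).
  apply/measurable_EFinP; apply: measurableT_comp => //.
  by apply: measurable_funS mg.
pose W s t : \bar R :=
  (\int[lebesgue_measure]_(u in I `&` `[s, t[) `|g u|%:E)%E.
have W0 s t : (0 <= W s t)%E by apply: integral_ge0 => u _; rewrite lee_fin.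
(* [g] may fail to be integrable on an unbounded [I], so finiteness is drawn from the local bound,
   with a radius t - s + 1 that is positive even for s = t. *)
have Wfin s t : W s t \is a fin_num.
  rewrite ge0_fin_numE //; have [st|ts] := lerP s t; last first.
    rewrite /W (_ : I `&` `[s, t[ = set0) ?integral_set0 ?ltry //.
    rewrite -subset0 => u [_]; rewrite /= in_itv /= => /andP[su ut].
    by move: (lt_trans (le_lt_trans su ut) ts); rewrite ltxx.
  have L0 : 0 < t - s + 1 by lra.
  have L3 : 0 <= t - s <= 3 * (t - s + 1) by apply/andP; split; lra.
  have := gM s _ _ L0 L3; rewrite (addrC s) subrK => /le_lt_trans; apply.
  by rewrite ltry.
pose V s t := fine (W s t).
have V0 s t : 0 <= V s t by rewrite fine_ge0.
have VD s t u : s <= t -> t <= u -> V s t + V t u <= V s u.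
  move=> st tu.
  have stu : I `&` `[s, u[ = (I `&` `[s, t[) `|` (I `&` `[t, u[).
    rewrite -setIUr; congr (_ `&` _); apply/seteqP; split => x /=.
      rewrite !in_itv /= => /andP[x1 x2]; have [xt|tx] := ltrP x t.
        by left; rewrite x1.
      by right; rewrite x2.
    rewrite !in_itv /= => -[] /andP[x1 x2].
      by rewrite x1 (lt_le_trans x2).
    by rewrite x2 (le_trans st).
  rewrite -lee_fin EFinD !fineK // /W stu ge0_integral_setU //.
  - exact: mIs.
  - exact: mIs.
  - by rewrite -stu; exact: mgIs.
  - apply/disj_setPS => x [[_ +] [_ +]]; rewrite /= !in_itv /=.
    by move=> /andP[_ xt] /andP[tx _]; move: (lt_le_trans xt tx); rewrite ltxx.
have fV s t u v : I u -> I v -> s <= u -> u < v -> v < t ->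
    `|f u - f v| <= V s t.
  move=> Iu Iv su uv vt; rewrite -lee_fin /V fineK //.
  exact: weak_deriv_osc gf Iu Iv su uv vt.
apply: ereal_inf_lbound; exists (1 + e * (theta / (1 - theta))) => //=.
split; first by rewrite ltr_pwDl.
(* The strip count 4 (rho / r) + 1 accounts for 5; since 2 / w = 4 / r, the integral term accounts
   for 4 M. *)
exists (5 + 4 * M); split; first by lra.
move=> z r rho [t0 It0 <-] r0 rle rho_lt rho1.
(* The radius is positive because it exceeds the nonnegative power rho^(1/theta). *)
have rho0 : 0 < rho.
  by rewrite (le_lt_trans _ rho_lt) // powR_ge0.
have r_rho : r <= rho by rewrite (le_trans rle) // ltW.
pose w := r / 2; have w0 : 0 < w by rewrite divr_gt0.
have q0 : 0 <= 2 * rho / w by rewrite divr_ge0 ?mulr_ge0 // ltW.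
have /andP[m1 m2] := truncn_itv q0.
(* The successor makes m w exceed 2 rho strictly, so that half-open strips starting at t0 - rho
   reach beyond t0 + rho. *)
set m := (Num.truncn _).+1 in m2.
have mw1 : 2 * rho < m%:R * w by rewrite -ltr_pdivrMr.
have mw2 : m%:R * w <= 2 * rho + w.
  by rewrite /m -natr1 mulrDl mul1r lerD2r -ler_pdivlMr.
have m3 : m%:R <= 4 * (rho / r) + 1.
  rewrite /m -natr1 lerD2r (le_trans m1) // /w le_eqVlt; apply/orP; left.
  by apply/eqP; field; rewrite gt_eqF.
have wr : 2 * w <= r by rewrite /w; lra.
have [n nm cn] := covered_by_strips R I f V r w w0 wr V0 VD fV m (t0 - rho).
(* The total width is at most 2 rho + r / 2 <= 3 rho, within the range of the local bound. *)
have VM : V (t0 - rho) (t0 - rho + m%:R * w) <= M * (rho * rho `^ (- e)).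
  rewrite -lee_fin /V fineK //; apply: gM => //.
  by move: mw1 mw2; rewrite /w => mw1 mw2; apply/andP; split; lra.
have ratio1 : 1 <= rho / r by rewrite ler_pdivlMr // mul1r.
(* The target power of rho / r is (rho / r) P. The factor [P] absorbs rho^(-e) in the integral term
   and, being at least 1, also dominates the strip count. *)
pose P := (rho / r) `^ (e * (theta / (1 - theta))).
have P1 : 1 <= P.
  apply: (@le_trans _ _ (1 `^ (e * (theta / (1 - theta))))).
    by rewrite powR1.
  by apply: ge0_ler_powR; rewrite ?nnegrE ?(le_trans _ ratio1).
have P2 : rho `^ (- e) <= P by apply: powR_ratio_ge => //; rewrite theta0.
apply: (@le_trans _ _ (n%:R)%:E).
  apply: ereal_inf_lbound; exists n => //.
  by apply: covered_by_subset cn; apply: disc_Graph_sub; lra.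
have ratio0 : 0 < rho / r := lt_le_trans ltr01 ratio1.
rewrite lee_fin (le_trans nm) // powRD ?(gt_eqF ratio0) ?implybT //.
rewrite powRr1 ?(ltW ratio0) // -/P.
have h1 : 2 / w * V (t0 - rho) (t0 - rho + m%:R * w) <= 4 * M * ((rho / r) * P).
  apply: (@le_trans _ _ (2 / w * (M * (rho * P)))).
    apply: ler_wpM2l; first by rewrite divr_ge0 // ltW.
    apply: le_trans VM _; apply: ler_wpM2l => //.
    by apply: ler_wpM2l => //; exact: ltW.
  rewrite le_eqVlt; apply/orP; left; apply/eqP.
  by rewrite /w; field; rewrite gt_eqF.
have h2 : rho / r <= rho / r * P by rewrite ler_peMr // (le_trans _ ratio1).
by rewrite mulrDl; lra.
Qed.
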